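(* For every Coxeter system $(W,S)$, the formal power series $W^{FC}(t)=\sum_{l\geq 0}|W^{FC}_l|\,t^l$ is a rational function of $t$. Equivalently, the sequence $(|W^{FC}_l|)_{l\ge 0}$ satisfies a linear recurrence with constant coefficients for all sufficiently large $l$.
   Context: A Coxeter system $(W,S)$ consists of a finite set $S$ and a symmetric matrix $(m_{st})_{s,t\in S}$ with $m_{ss}=1$ and $m_{st}\in\{2,3,\dots\}\cup\{\infty\}$ for $s\neq t$; $W$ is the group generated by $S$ subject to $(st)^{m_{st}}=1$ whenever $m_{st}<\infty$. The length $\ell(w)$ of $w\in W$ is the smallest $l$ such that $w=s_1\cdots s_l$ with $s_i\in S$; such words of length $\ell(w)$ are the reduced expressions of $w$, forming the set $\mathcal R(w)\subseteq S^*$. Two words in $S^*$ are commutation equivalent if one can pass from one to the other by repeatedly replacing a factor $st$ by $ts$ where $m_{st}=2$. An element $w\in W$ is fully commutative (FC) if $\mathcal R(w)$ is a single commutation equivalence class. $W^{FC}$ denotes the set of FC elements and $W^{FC}_l$ the set of FC elements of length $l$. *)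

(* Defs.v *)
From HB Require Import structures.
From Stdlib Require Import ClassicalEpsilon.
From mathcomp Require Import all_boot all_order all_algebra.
Set Implicit Arguments. Unset Strict Implicit. Unset Printing Implicit Defensive.
Import Order.TTheory GRing.Theory Num.Theory.

(* Coxeter matrix: m s t = None encodes m_{st} = infinity. *)
Definition coxeter_matrix (S : finType) (m : S -> S -> option nat) : Prop :=
  (forall s, m s s = Some 1%N) /\
  (forall s t, m s t = m t s) /\
  (forall s t, s <> t -> forall k, m s t = Some k -> 2 <= k).

(* Equality in W of (positive) words: the congruence on S^* generated by the
   relators (st)^{m_st} = 1 (m_st finite). Since m_ss = 1 gives s s = 1, the
   monoid so presented is the Coxeter group W. *)
Inductive wequiv (S : finType) (m : S -> S -> option nat) : seq S -> seq S -> Prop :=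
| weq_refl u : wequiv m u u
| weq_sym u v : wequiv m u v -> wequiv m v u
| weq_trans u v w : wequiv m u v -> wequiv m v w -> wequiv m u w
| weq_rel s t k u v : m s t = Some k ->
    wequiv m (u ++ flatten (nseq k [:: s; t]) ++ v) (u ++ v).

Inductive cequiv (S : finType) (m : S -> S -> option nat) : seq S -> seq S -> Prop :=
| ceq_refl u : cequiv m u u
| ceq_sym u v : cequiv m u v -> cequiv m v u
| ceq_trans u v w : cequiv m u v -> cequiv m v w -> cequiv m u w
| ceq_rel s t u v : m s t = Some 2%N ->
    cequiv m (u ++ [:: s; t] ++ v) (u ++ [:: t; s] ++ v).

Definition reduced (S : finType) (m : S -> S -> option nat) (u : seq S) : Prop :=
  forall v, wequiv m u v -> size u <= size v.

Definition fully_commutative (S : finType) (m : S -> S -> option nat) (u : seq S) : Prop :=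
  forall v1 v2, wequiv m u v1 -> wequiv m u v2 ->
    reduced m v1 -> reduced m v2 -> cequiv m v1 v2.

Definition pbool (P : Prop) : bool :=
  if excluded_middle_informative P then true else false.

(* |W^FC_l|: number of FC elements of length l, counted via the unique
   representative (minimal in the enumeration order of l-tuples) of each
   element among its reduced expressions of length l. *)
Definition card_FC (S : finType) (m : S -> S -> option nat) (l : nat) : nat :=
  #|[set w : l.-tuple S | pbool
      [/\ reduced m w, fully_commutative m w &
          forall w' : l.-tuple S, wequiv m w' w -> enum_rank w <= enum_rank w']]|.

(* Main.v *)
(** The proof rests on Stembridge's description of fully commutative elements: a word is a
    reduced word of one iff no word in its commutation class contains a factor [ss] or one
    side of a braid relation other than [st = ts]. This follows from the exchange condition,
    which is obtained from the presentation alone: the parity of the number of times a word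
    crosses a given reflection depends only on the group element it represents.

    Avoiding a finite set of factors modulo commutations is recognized by a finite automaton,
    because the left quotient by a letter of a trace language [X^* g S^*] is a finite union of
    languages [X'^* g' S^*] with [X'] a subset of [X] and [g'] no longer than [g]. A second
    automaton selects the lexicographic normal form of each commutation class. The counting
    sequence is thus governed by a transfer matrix, and Cayley-Hamilton gives the recurrence. *)

From Stdlib Require Import Classical ClassicalEpsilon.
Require Import Defs.
From mathcomp Require Import all_boot all_order all_algebra.
Import GRing.Theory.
Local Open Scope ring_scope.

(** * Rationality of sequences governed by a transfer matrix *)

Section TransferMatrix.
Set Implicit Arguments. Unset Strict Implicit. Unset Printing Implicit Defensive.

Definition rational_series (c : nat -> rat) : Prop :=
  exists P Q : {poly rat},
    Q`_0 != 0 /\ forall n, \sum_(i < n.+1) Q`_i * c (n - i)%N = P`_n.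

Lemma horner_mx_coef (R : comNzRingType) n (A : 'M[R]_n.+1) (p : {poly R}) :
  horner_mx A p = \sum_(i < size p) p`_i *: A ^+ i.
Proof.
rewrite -[p in LHS]coefK poly_def rmorph_sum /=.
by apply: eq_bigr => i _; rewrite linearZ /= rmorphXn /= horner_mx_X.
Qed.

Lemma recurrence_rational (c : nat -> rat) n (p : {poly rat}) :
    p`_n != 0 ->
    (forall l, \sum_(i < n.+1) p`_i * c (l + i)%N = 0) ->
  rational_series c.
Proof.
move=> pn rec.
(* Reversing [p] turns its nonzero coefficient of index [n] into the constant term of [Q]. From
   degree [n] on, the coefficients of the product of [Q] with the series are instances of the
   recurrence. *)
pose Q : {poly rat} := \poly_(i < n.+1) p`_(n - i).
exists (\poly_(k < n) \sum_(i < k.+1) Q`_i * c (k - i)%N), Q; split.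
  by rewrite coef_poly subn0.
move=> k; rewrite coef_poly; case: ltnP => // le_nk.
rewrite -[RHS](rec (k - n)%N) (reindex_inj rev_ord_inj) /=.
rewrite [RHS](reindex_inj rev_ord_inj) /=.
transitivity (\sum_(i < k.+1 | (i < n.+1)%N) Q`_i * c (k - i)%N).
  rewrite -(big_mkord xpredT (fun i => Q`_(k.+1 - i.+1) * c (k - (k.+1 - i.+1))%N)).
  rewrite -(big_mkord (fun i => i < n.+1)%N (fun i => Q`_i * c (k - i)%N)).
  rewrite big_nat_rev /= add0n [RHS]big_mkcond /= !big_mkord.
  apply: eq_bigr => i _.
  rewrite !subSS (subKn (leq_ord i)) [Q`_i]coef_poly.
  by case: ifP => // _; rewrite mul0r.
rewrite -(big_ord_widen k.+1 (fun i => Q`_i * c (k - i)%N)) ?ltnS //.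
apply: eq_bigr => i _; rewrite coef_poly ltn_ord subSS.
by congr (_ * c _); rewrite addnBA ?leq_ord // subnK.
Qed.

Lemma transfer_matrix_rational (Q : finType) (c : Q -> nat -> rat)
    (M : Q -> Q -> rat) (q0 : Q) :
    (forall q l, c q l.+1 = \sum_q' M q q' * c q' l) ->
  rational_series (c q0).
Proof.
move=> step.
(* [horner_mx_coef] is about matrices of positive size; [q0] shows that [Q] is nonempty. *)
have [n Qn] : exists n, n.+1 = #|Q|.
  by exists #|Q|.-1; rewrite prednK //; apply/card_gt0P; exists q0.
pose enc q := cast_ord (esym Qn) (enum_rank q).
pose dec i := enum_val (cast_ord Qn i).
have encK : cancel enc dec by move=> q; rewrite /dec /enc cast_ordKV enum_rankK.
have decK : cancel dec enc by move=> i; rewrite /dec /enc enum_valK cast_ordK.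
pose A : 'M[rat]_n.+1 := \matrix_(i, j) M (dec i) (dec j).
pose v l : 'cV[rat]_n.+1 := \col_i c (dec i) l.
have vS l : v l.+1 = A *m v l.
  apply/colP => i; rewrite !mxE step (reindex dec) /=; last by exists enc => ? _.
  by apply: eq_bigr => j _; rewrite !mxE.
have vD l k : v (l + k)%N = A ^+ k *m v l.
  elim: k => [|k IH]; first by rewrite addn0 expr0 mul1mx.
  by rewrite addnS vS IH exprS mulmxA.
have sz := size_char_poly A.
apply: (@recurrence_rational _ n.+1 (char_poly A)).
  have := monicP (char_poly_monic A).
  by rewrite lead_coefE sz /= => ->; rewrite oner_eq0.
move=> l; have := Cayley_Hamilton A; rewrite horner_mx_coef sz => CH.
have /colP/(_ (enc q0)) : (\sum_(i < n.+2) (char_poly A)`_i *: A ^+ i) *m v l = 0.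
  by rewrite CH mul0mx.
rewrite mulmx_suml summxE mxE => sum0; rewrite -[RHS]sum0.
by apply: eq_bigr => i _; rewrite -scalemxAl -vD !mxE encK.
Qed.

End TransferMatrix.

(** * Traces: words up to commutations *)

Section Traces.
Set Implicit Arguments. Unset Strict Implicit. Unset Printing Implicit Defensive.
Local Open Scope nat_scope.

Lemma pboolP P : reflect P (pbool P).
Proof. by rewrite /pbool; case: excluded_middle_informative => h; constructor. Qed.

Variables (S : finType) (m : S -> S -> option nat).
Hypothesis m_cox : coxeter_matrix m.
Implicit Types (a b s t : S) (u v w p q g : seq S) (X Z : {set S}).

Definition comm s t := m s t == Some 2.

Lemma comm_irr s : comm s s = false.
Proof. by rewrite /comm (proj1 m_cox). Qed.

Lemma comm_sym s t : comm s t = comm t s.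
Proof. by rewrite /comm (proj1 (proj2 m_cox)). Qed.

Local Notation "u =c v" := (cequiv m u v) (at level 70).

Lemma cequiv_cat p q u v : u =c v -> p ++ u ++ q =c p ++ v ++ q.
Proof.
elim=> {u v} [u|u v _ /ceq_sym //|u v w _ uv _|s t u v st].
- exact: ceq_refl.
- exact: ceq_trans.
- by have := ceq_rel (p ++ u) (v ++ q) st; rewrite -!catA.
Qed.

Lemma cequiv_cons a u v : u =c v -> a :: u =c a :: v.
Proof. by move=> /(cequiv_cat [:: a] [::]); rewrite !cats0. Qed.

Lemma cequiv_perm u v : u =c v -> perm_eq u v.
Proof.
elim=> {u v} [//|u v _|u v w _ uv _ /(perm_trans uv) //|s t u v _].
  by rewrite perm_sym.
by rewrite perm_cat2l perm_cat2r; apply/permP => x /=; rewrite !addn0 addnC.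
Qed.

Lemma cequiv_size u v : u =c v -> size u = size v.
Proof. by move=> /cequiv_perm/perm_size. Qed.

Lemma cequiv_swap_block a p q : all (comm a) p -> a :: p ++ q =c p ++ a :: q.
Proof.
elim: p => [|b p IH] /=; first by move=> _; apply: ceq_refl.
case/andP=> /eqP ab /IH/(cequiv_cons b); apply: ceq_trans.
exact: (ceq_rel [::] (p ++ q) ab).
Qed.

(* A trace has [a] as a minimal letter iff [derive a] of any representative is defined,
   and then it is what remains after cancelling [a] on the left. *)
Fixpoint derive a w : option (seq S) :=
  if w is b :: w' then
    if a == b then Some w'
    else if comm a b then omap (cons b) (derive a w') else None
  else None.

Lemma deriveE a w w' : derive a w = Some w' -> w =c a :: w'.
Proof.
elim: w w' => [|b w IH] w' //=.
case: eqP => [->|_]; first by case=> ->; apply: ceq_refl.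
case: ifP => // /eqP ab; case D: (derive a w) => [v|] //= [<-].
apply: ceq_trans (cequiv_cons b (IH _ D)) _.
by apply: ceq_sym; apply: (ceq_rel [::] v ab).
Qed.

Lemma derive_head a w : derive a (a :: w) = Some w.
Proof. by rewrite /= eqxx. Qed.

Lemma derive_cat a u v :
  derive a (u ++ v) =
    if derive a u is Some u' then Some (u' ++ v)
    else if all (comm a) u then omap (cat u) (derive a v) else None.
Proof.
elim: u => [|b u IH] /=; first by case: (derive a v).
case: eqP => [//|_]; case: (comm a b) => //=.
by rewrite IH; case: (derive a u) => // /=; case: ifP => //; case: (derive a v).
Qed.

Definition oequiv (x y : option (seq S)) :=
  match x, y with
  | Some u, Some v => u =c v
  | None, None => True
  | _, _ => False
  end.

Lemma derive_swap a s t v : comm s t ->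
  oequiv (derive a [:: s, t & v]) (derive a [:: t, s & v]).
Proof.
move=> st; have neq_st : s == t = false.
  by apply/eqP => e; rewrite e comm_irr in st.
rewrite /=; case: (eqVneq a s) => [->|nas].
  by rewrite neq_st st /=; apply: ceq_refl.
case: (eqVneq a t) => [->|nat_].
  by rewrite comm_sym st /=; apply: ceq_refl.
case: (comm a s); case: (comm a t) => //=; case: (derive a v) => //= w.
exact: (ceq_rel [::] w (eqP st)).
Qed.

(** Left division by a letter thus acts on traces: neither the minimality of [a] nor the quotient
    depends on the representative. *)
Lemma derive_cequiv a u v : u =c v -> oequiv (derive a u) (derive a v).
Proof.
elim=> {u v} [u|u v _|u v w _ uv _ vw|s t u v st].
- by case: (derive a u) => //= w; apply: ceq_refl.
- by case: (derive a u); case: (derive a v) => //= ? ?; apply: ceq_sym.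
- case: (derive a u) (derive a v) (derive a w) uv vw => [?|] [?|] [?|] //=.
  exact: ceq_trans.
- rewrite !(derive_cat a u); case: (derive a u) => [u'|] /=.
    exact: (ceq_rel u' v st).
  case: ifP => // _; have := derive_swap a v (introT eqP st); rewrite /=.
  case: (if a == s then _ else _); case: (if a == t then _ else _) => //= x y.
  by move=> /(cequiv_cat u [::]); rewrite !cats0.
Qed.

Lemma cequiv_cancel a u v : a :: u =c a :: v -> u =c v.
Proof. by move=> /(derive_cequiv a); rewrite /= eqxx. Qed.

Lemma derive_isSome a u v : u =c v -> derive a u -> derive a v.
Proof. by move=> /(derive_cequiv a); case: (derive a u); case: (derive a v). Qed.

(** Starting from [set0], [Z] collects the letters that commute with some suffix of what has been
    read and are smaller than the first letter of that suffix. Reading one of them would reveal a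
    lexicographically smaller word of the same trace. The sets [Z] are the states of the automaton
    for normal forms. *)
Fixpoint nf Z w : bool :=
  if w is a :: w' then
    (a \notin Z) &&
      nf [set b | comm a b & (b \in Z) || (enum_rank b < enum_rank a)] w'
  else true.

(** A letter of [Z] stays excluded while letters commuting with it are read. All letters before the
    first occurrence of a minimal letter [b] commute with [b], so it would still be excluded when
    reached. *)
Lemma nf_avoid Z w b : nf Z w -> derive b w -> b \notin Z.
Proof.
elim: w Z => [|a w IH] Z //= /andP[aZ nfw]; case: eqP => [->|_] //.
case: ifP => // ba Dw; have := IH _ nfw.
case: (derive b w) Dw => // x _ /(_ isT).
by rewrite inE comm_sym ba negb_or => /andP[].
Qed.

Lemma nf_head_min Z w a b :
  nf Z (a :: w) -> derive b (a :: w) -> enum_rank a <= enum_rank b.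
Proof.
move=> /= /andP[aZ nfw]; case: eqP => [->|_] //.
case: ifP => // ba Dw; have := nf_avoid (b := b) nfw.
case: (derive b w) Dw => // x _ /(_ isT).
by rewrite inE comm_sym ba negb_or -leqNgt => /andP[].
Qed.

(** Both words start with the least minimal letter of their common trace, and that letter
    cancels. *)
Lemma nf_uniq Z u v : nf Z u -> nf Z v -> u =c v -> u = v.
Proof.
elim: u Z v => [|a u IH] Z [|b v] nfu nfv uv //.
- by have := cequiv_size uv.
- by have := cequiv_size uv.
have ab : a = b.
  apply/enum_rank_inj/val_inj/eqP; rewrite eqn_leq.
  rewrite (nf_head_min nfu) ?(nf_head_min nfv) //.
    by apply: derive_isSome uv _; rewrite derive_head.
  by apply: derive_isSome (ceq_sym uv) _; rewrite derive_head.
rewrite -ab in nfv uv *.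
move: nfu nfv => /= /andP[_ nfu] /andP[_ nfv].
by rewrite (IH _ _ nfu nfv (cequiv_cancel uv)).
Qed.

Lemma nf_exists Z w : (forall b, derive b w -> b \notin Z) ->
  exists2 v, nf Z v & w =c v.
Proof.
have [n] := ubnP (size w); elim: n w Z => // n IH [|c w] Z wn avoid.
  by exists [::] => //; apply: ceq_refl.
have Dc : derive c (c :: w) by rewrite derive_head.
(* Greedy choice: the least minimal letter goes first. *)
case: (@arg_minnP _ c (fun b => derive b (c :: w)) (fun b => enum_rank b) Dc) => a.
case Da: (derive a (c :: w)) => [w'|] // _ amin.
have wE := deriveE Da.
have [||v nfv w'v] := IH w' [set b | comm a b & (b \in Z) || (enum_rank b < enum_rank a)].
- by have := cequiv_size wE; rewrite /= => -[<-].
(* A minimal letter of the quotient that commutes with [a] was already minimal before, hence lies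
   outside [Z] and is not below [a]. *)
- move=> b Db; rewrite inE; case: (boolP (comm a b)) => //= ab.
  have Db' : derive b (c :: w).
    apply: derive_isSome (ceq_sym wE) _ => /=.
    case: eqP => // _; rewrite comm_sym ab.
    by case: (derive b w') Db.
  by rewrite negb_or avoid //= -leqNgt amin.
exists (a :: v) => /=.
  by rewrite nfv andbT avoid // Da.
by apply: ceq_trans wE _; apply: cequiv_cons.
Qed.

(* [pattern_in X g] is the trace language [X^* g S^*]. The left quotient of such a language
   by a letter is a finite union of languages of the same shape, which is what makes it
   recognizable. *)
Definition pattern_in X g w :=
  exists p q, all [in X] p /\ w =c p ++ g ++ q.

Definition links a : {set S} := [set b | comm a b].

(** The three cases tell whether the minimal letter [a] is taken from the prefix [p], from [g] or
    from [q]. In the last two it has to pass [p], so the letters of [p] are confined to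
    [links a]. *)
Lemma pattern_in_cons X g a w : pattern_in X g (a :: w) <->
  [\/ a \in X /\ pattern_in X g w,
      exists2 g', derive a g = Some g' & pattern_in (X :&: links a) g' w
    | all (comm a) g /\ pattern_in (X :&: links a) g w].
Proof.
have all_links p : all [in X :&: links a] p = all [in X] p && all (comm a) p.
  by rewrite -all_predI; apply: eq_all => b; rewrite !inE.
split.
  case=> p [q [pX]] /[dup] E /(derive_cequiv a).
  rewrite derive_head derive_cat derive_cat.
  case Dp: (derive a p) => [p'|].
    move=> wE; have /perm_all Ep := cequiv_perm (deriveE Dp).
    move: pX; rewrite Ep /= => /andP[aX p'X].
    by constructor 1; split => //; exists p', q.
  case: ifP => // pa; case Dg: (derive a g) => [g'|] /=.
    by move=> wE; constructor 2; exists g' => //; exists p, q; rewrite all_links pX.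
  case: ifP => // ga; case Dq: (derive a q) => [q'|] //= wE.
  by constructor 3; split => //; exists p, q'; rewrite all_links pX.
case=> [[aX [p [q [pX wE]]]]|[g' Dg [p [q []]]]|[ga [p [q []]]]].
- by exists (a :: p), q; rewrite /= aX; split => //; apply: cequiv_cons.
- rewrite all_links => /andP[pX pa] wE; exists p, q; split => //.
  apply: ceq_trans (cequiv_cons a wE) _.
  apply: ceq_trans (cequiv_swap_block _ pa) _.
  have := cequiv_cat p q (deriveE Dg); rewrite -cat_cons.
  exact: ceq_sym.
- rewrite all_links => /andP[pX pa] wE; exists p, (a :: q); split => //.
  apply: ceq_trans (cequiv_cons a wE) _; rewrite !catA.
  by apply: cequiv_swap_block; rewrite all_cat pa.
Qed.

Lemma derive_size a g g' : derive a g = Some g' -> size g = (size g').+1.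
Proof. by move=> /deriveE/cequiv_size. Qed.

(** * Subset automaton for trace patterns *)

Section Automaton.
Variable N : nat.
Local Notation pattern := ({set S} * bseq_of N S)%type.
Implicit Type A : {set pattern}.

(** A state is a set of patterns, read as the union of their languages. The bound [N] makes the
    states finite in number, and left division never lengthens a pattern. *)
Definition matches A w := exists2 x, x \in A & pattern_in x.1 x.2 w.

Definition step a (x y : pattern) :=
  [|| (a \in x.1) && (y == x),
      (derive a x.2 == Some (y.2 : seq S)) && (y.1 == x.1 :&: links a)
    | [&& all (comm a) x.2, y.1 == x.1 :&: links a & y.2 == x.2]].

Definition next A a : {set pattern} := [set y | [exists x in A, step a x y]].

Lemma matches_cons A a w : matches A (a :: w) <-> matches (next A a) w.
Proof.
split=> [[x xA /pattern_in_cons[[aX]|[g' Dg]|[ga]] Tw]|].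
- exists x => //; rewrite inE; apply/exists_inP; exists x => //.
  by rewrite /step aX eqxx.
- have sg' : size g' <= N.
    by rewrite ltnW // -(derive_size Dg) size_bseq.
  exists (x.1 :&: links a, Bseq sg') => //; rewrite inE; apply/exists_inP; exists x => //.
  by rewrite /step Dg !eqxx !orbT.
- exists (x.1 :&: links a, x.2) => //; rewrite inE; apply/exists_inP; exists x => //.
  by rewrite /step ga !eqxx !orbT.
case=> y /[!inE] /exists_inP[x xA xy] Ty; exists x => //; apply/pattern_in_cons.
case/or3P: xy => [/andP[aX /eqP yx]|/andP[/eqP Dg /eqP yE]|/and3P[ga /eqP yE /eqP gE]].
- by constructor 1; split=> //; rewrite -yx.
- by constructor 2; exists y.2; rewrite -?yE.
- by constructor 3; split=> //; rewrite -yE -gE.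
Qed.

End Automaton.

Lemma card_tuple_cons (P : pred (seq S)) l :
  #|[set w : l.+1.-tuple S | P w]| =
  \sum_a #|[set w : l.-tuple S | P (a :: w)]|.
Proof.
rewrite -sum1_card (eq_bigl (fun w : l.+1.-tuple S => P w)); last first.
  by move=> w; rewrite inE.
rewrite (reindex (fun x : S * l.-tuple S => cons_tuple x.1 x.2)) /=; last first.
  exists (fun w : l.+1.-tuple S => (thead w, behead_tuple w)) => [[a w]|w] _ /=.
    by rewrite theadE; congr (_, _); apply: val_inj.
  by rewrite [RHS]tuple_eta; apply: val_inj.
rewrite -(pair_big_dep xpredT (fun a (w : l.-tuple S) => P (a :: w)) (fun _ _ => 1)) /=.
apply: eq_bigr => a _; rewrite sum1_card.
by apply: eq_card => w; rewrite !inE.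
Qed.

Definition avoids (F : seq (seq S)) w :=
  forall p f q, f \in F -> ~ w =c p ++ f ++ q.

Lemma avoiding_nf_rational (F : seq (seq S)) :
  rational_series (fun l =>
    #|[set w : l.-tuple S | nf set0 w && pbool (avoids F w)]|%:R).
Proof.
pose N := \max_(f <- F) size f.
(* Product of the two automata: [ok x] is the language accepted from state [x], and [M x y] counts
   the admissible letters leading from [x] to [y]. *)
pose Q := ({set ({set S} * bseq_of N S)} * {set S})%type.
pose ok (x : Q) w := nf x.2 w && ~~ pbool (matches x.1 w).
pose c (x : Q) l : rat := #|[set w : l.-tuple S | ok x w]|%:R.
pose nx (x : Q) a : Q :=
  (next x.1 a, [set b | comm a b & (b \in x.2) || (enum_rank b < enum_rank a)]).
pose M (x y : Q) : rat := (\sum_(a | a \notin x.2) (nx x a == y)%:R)%R.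
(* With [setT] the prefix is unconstrained, so matching means containing a word of [F] as a factor
   up to commutations. *)
pose q0 : Q := ([set x | (x.1 == setT) && (val x.2 \in F)], set0).
have : rational_series (c q0).
  apply: (@transfer_matrix_rational Q c M) => x l.
  transitivity (\sum_(a | a \notin x.2) c (nx x a) l)%R.
    rewrite /c card_tuple_cons natr_sum [RHS]big_mkcond; apply: eq_bigr => a _.
    rewrite /ok /=; case: ifP => aZ; last first.
      by apply: (congr1 (fun k => k%:R : rat) (eq_card0 _)) => w; rewrite !inE.
    congr (_%:R); apply: eq_card => w; rewrite !inE.
    by congr (_ && ~~ _); apply/pboolP/pboolP => /matches_cons.
  under [RHS]eq_bigr => y _ do rewrite /M mulr_suml.
  rewrite exchange_big /=; apply: eq_bigr => a _.
  rewrite (bigD1 (nx x a)) //= eqxx mul1r big1 ?addr0 // => y ne.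
  by rewrite eq_sym (negbTE ne) mul0r.
case=> P [R [R0 PR]]; exists P, R; split => // n; rewrite -PR.
apply: eq_bigr => i _; congr (_ * _%:R)%R; apply: eq_card => w; rewrite !inE.
rewrite /ok /=; congr (_ && _); apply/pboolP/negP => [av /pboolP[x]|nm p f q fF wE].
  by rewrite inE => /andP[_ xF] [p [q [_ wE]]]; apply: (av _ _ _ xF wE).
have sf : size f <= N by rewrite /N; apply: leq_bigmax_seq.
apply/nm/pboolP; exists (setT, Bseq sf); first by rewrite inE eqxx.
by exists p, q; split => //; apply/allP => b _; rewrite inE.
Qed.

End Traces.

(** * Words modulo the Coxeter relations *)

Section CoxeterGroups.
Set Implicit Arguments. Unset Strict Implicit. Unset Printing Implicit Defensive.
Local Open Scope nat_scope.

Variables (S : finType) (m : S -> S -> option nat).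
Hypothesis m_cox : coxeter_matrix m.
Implicit Types (a b s t : S) (u v w x y z p q r f : seq S) (k l : nat).

Local Notation "u =c v" := (cequiv m u v) (at level 70).
Local Notation "u ~ v" := (wequiv m u v) (at level 70).

Lemma wequiv_cat p q u v : u ~ v -> p ++ u ++ q ~ p ++ v ++ q.
Proof.
elim=> {u v} [u|u v _ /weq_sym //|u v w _ uv _|s t k u v st].
- exact: weq_refl.
- exact: weq_trans.
- by have := weq_rel (p ++ u) (v ++ q) st; rewrite -!catA.
Qed.

Lemma wequiv_catl p u v : u ~ v -> p ++ u ~ p ++ v.
Proof. by move=> /(wequiv_cat p [::]); rewrite !cats0. Qed.

Lemma wequiv_catr q u v : u ~ v -> u ++ q ~ v ++ q.
Proof. exact: (wequiv_cat [::] q). Qed.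

Lemma wequiv_cons s u v : u ~ v -> s :: u ~ s :: v.
Proof. exact: (wequiv_catl [:: s]). Qed.

Lemma wequiv_ss s u : [:: s, s & u] ~ u.
Proof. exact: (weq_rel [::] u (proj1 m_cox s)). Qed.

Lemma wequiv_move s u v : s :: u ~ v <-> u ~ s :: v.
Proof.
split=> [suv|usv].
  by apply: weq_trans (wequiv_cons s suv); apply: weq_sym; apply: wequiv_ss.
by apply: weq_trans (wequiv_cons s usv) _; apply: wequiv_ss.
Qed.

Lemma wequiv_cancel s u v : s :: u ~ s :: v -> u ~ v.
Proof. by move=> /wequiv_move h; apply: weq_trans h _; apply: wequiv_ss. Qed.

Lemma wequiv_rcons_ss s u : rcons (rcons u s) s ~ u.
Proof.
rewrite -!cats1 -catA -[X in _ ~ X]cats0; apply: wequiv_catl; exact: wequiv_ss.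
Qed.

Lemma wequiv_conj s u v : u ~ s :: rcons v s <-> s :: rcons u s ~ v.
Proof.
split=> h.
  apply/wequiv_move; rewrite -cats1; apply: weq_trans (wequiv_catr [:: s] h) _.
  by rewrite cats1 /=; apply: wequiv_cons; apply: wequiv_rcons_ss.
apply: weq_sym; apply/wequiv_move; rewrite -cats1.
apply: weq_trans (wequiv_catr [:: s] (weq_sym h)) _.
by rewrite cats1 /=; apply: wequiv_cons; apply: wequiv_rcons_ss.
Qed.

Lemma rev_cat_wequiv p u : rev p ++ p ++ u ~ u.
Proof.
elim: p u => [|s p IH] u; first exact: weq_refl.
rewrite rev_cons cat_rcons /=; apply: weq_trans (IH u).
by apply: wequiv_catl; apply: wequiv_ss.
Qed.

Lemma wequiv_cancelr x u v : u ++ x ~ v ++ x -> u ~ v.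
Proof.
have xx y : (y ++ x) ++ rev x ~ y.
  have := wequiv_catl y (rev_cat_wequiv (rev x) [::]).
  by rewrite revK !cats0 catA.
move=> /(wequiv_catr (rev x)) h.
exact: weq_trans (weq_sym (xx u)) (weq_trans h (xx v)).
Qed.

Lemma cequiv_wequiv u v : u =c v -> u ~ v.
Proof.
elim=> {u v} [u|u v _ /weq_sym //|u v w _ uv _|s t u v st].
- exact: weq_refl.
- exact: weq_trans.
- apply: wequiv_cat.
  (* Inserting the trivial word [tsst] gives [st = ts(stst) = ts]. *)
  have tsst : [:: t; s; s; t] ~ [::].
    apply: weq_trans (wequiv_ss t [::]).
    by apply: wequiv_cons; apply: wequiv_ss.
  apply: weq_trans (weq_sym (wequiv_catr [:: s; t] tsst)) _.
  apply: weq_trans (wequiv_cat [:: t; s] [::] (weq_rel [::] [::] st)) _.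
  exact: weq_refl.
Qed.

(** * Alternating words and the parity of wall crossings *)

Fixpoint braid s t k : seq S := if k is k'.+1 then s :: braid t s k' else [::].

Lemma size_braid s t k : size (braid s t k) = k.
Proof. by elim: k s t => //= k IH s t; rewrite IH. Qed.

Lemma braid_even_cat s t k l : braid s t (k.*2 + l) = braid s t k.*2 ++ braid s t l.
Proof. by elim: k => //= k ->. Qed.

Lemma braid_rcons s t k :
  braid s t k.+1 = rcons (braid s t k) (if odd k then t else s).
Proof.
elim: k s t => [//|k IH] s t; rewrite [LHS]/= -/(braid t s k.+1) IH /=.
by case: (odd k).
Qed.

Lemma flatten_nseq_braid s t k : flatten (nseq k [:: s; t]) = braid s t k.*2.
Proof. by elim: k => //= k ->. Qed.

(* Parity of the number of prefixes [p ++ [:: a]] of [u] with [p a p^-1 = r] in the group;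
   when [r] is a reflection, this tells whether [u] crosses its wall an odd number of times. *)
Fixpoint refl_odd u r : bool :=
  if u is s :: u' then pbool ([:: s] ~ r) (+) refl_odd u' (s :: rcons r s)
  else false.

Lemma refl_odd_wequivr u r r' : r ~ r' -> refl_odd u r = refl_odd u r'.
Proof.
elim: u r r' => //= s u IH r r' rr'; congr (_ (+) _).
  by apply/pboolP/pboolP => /weq_trans; apply => //; apply: weq_sym.
by apply: IH; rewrite -!cats1; apply: wequiv_cons; apply: wequiv_catr.
Qed.

(** Once [u] is read, the remaining word sees [r] conjugated by the inverse of [u], which [rev u]
    represents since generators are involutions. *)
Lemma refl_odd_cat u v r :
  refl_odd (u ++ v) r = refl_odd u r (+) refl_odd v (rev u ++ r ++ u).
Proof.
elim: u r => [|s u IH] r /=; first by rewrite cats0.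
by rewrite IH addbA rev_cons cat_rcons cat_cons cat_rcons.
Qed.

(** Conjugating a letter of an alternating word by the prefix before it gives again an alternating
    word, of odd length. *)
Lemma refl_odd_braid s t k r :
  refl_odd (braid s t k) r = \big[addb/false]_(i < k) pbool (braid s t i.*2.+1 ~ r).
Proof.
elim: k s t r => [|k IH] s t r; first by rewrite big_ord0.
rewrite big_ord_recl /= IH; congr (_ (+) _); apply: eq_bigr => i _.
have -> : [:: s, t, s & braid t s (0 + i).*2] = s :: rcons (braid t s i.*2.+1) s.
  by congr (_ :: _); rewrite -[LHS]/(braid t s i.*2.+2) braid_rcons /= odd_double.
by apply/pboolP/pboolP => /wequiv_conj.
Qed.

(* The reflections crossed by [(st)^k] form a sequence of length [2k] and period [k]. *)
Lemma refl_odd_relator s t k r : m s t = Some k -> refl_odd (braid s t k.*2) r = false.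
Proof.
move=> st; rewrite refl_odd_braid -addnn big_split_ord.
rewrite -[RHS](addbb (\big[addb/false]_(i < k) pbool (braid s t i.*2.+1 ~ r))).
congr (_ (+) _); apply: eq_bigr => i _.
rewrite -[nat_of_ord (rshift k i)]/(k + i) doubleD -addnS braid_even_cat -flatten_nseq_braid.
have rel := weq_rel [::] (braid s t i.*2.+1) st.
by apply/pboolP/pboolP; apply: weq_trans => //; apply: weq_sym.
Qed.

Lemma refl_odd_wequiv u v r : u ~ v -> refl_odd u r = refl_odd v r.
Proof.
move=> uv; elim: uv r => {u v} [u|u v _ IH|u v w _ IH1 _ IH2|s t k u v st] r //.
- by rewrite IH1.
rewrite !refl_odd_cat flatten_nseq_braid refl_odd_relator //=; congr (_ (+) _).
apply: refl_odd_wequivr; rewrite -flatten_nseq_braid.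
(* The relator [d] is trivial in the group, so conjugating by it does not change the reflection seen
   by the suffix [v]. *)
set d := flatten _; set r' := rev u ++ r ++ u.
have d1 : d ~ [::] by have := weq_rel [::] [::] st; rewrite cats0.
apply: (@weq_trans _ _ _ (rev d ++ r')).
  by apply: wequiv_catl; rewrite -[X in _ ~ X]cats0; apply: wequiv_catl.
apply: weq_trans (rev_cat_wequiv d r'); apply: wequiv_catl.
by apply: weq_sym; apply: (wequiv_catr r' d1).
Qed.

(** An odd count is nonzero, so [r] equals [p a p^-1] for some prefix [p a] of [u], and multiplying
    [u] by it on the left deletes this [a]. *)
Lemma refl_odd_delete u r : refl_odd u r ->
  exists p a q, u = p ++ a :: q /\ r ++ u ~ p ++ q.
Proof.
elim: u r => //= s u IH r; case: (pboolP ([:: s] ~ r)) => [sr _|_ /= /IH].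
  exists [::], s, u; split => //=; apply: weq_trans (wequiv_ss s u).
  exact: (wequiv_catr (s :: u) (weq_sym sr)).
case=> p [a [q [-> h]]]; exists (s :: p), a, q; split => //.
by move: h; rewrite /= cat_rcons => /wequiv_move.
Qed.

(** * Reduced words, exchange and pairs of left descents *)

Local Notation reduced := (reduced m).

Lemma reduced_exists u : exists2 v, u ~ v & reduced v.
Proof.
have [n] := ubnP (size u); elim: n u => // n IH u un.
case: (pboolP (reduced u)) => [ru|nru]; first by exists u => //; apply: weq_refl.
have [v uv vu] : exists2 v, u ~ v & size v < size u.
  apply: NNPP => no; apply: nru => v uv; rewrite leqNgt; apply/negP => vu.
  by apply: no; exists v.
have [|w vw rw] := IH v; first by apply: leq_trans vu _.
by exists w => //; apply: weq_trans vw.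
Qed.

Lemma reduced_size_eq u v : reduced u -> reduced v -> u ~ v -> size u = size v.
Proof.
by move=> ru rv uv; apply/eqP; rewrite eqn_leq ru // rv //; apply: weq_sym.
Qed.

Lemma reduced_wequiv u v : reduced u -> u ~ v -> size v <= size u -> reduced v.
Proof.
by move=> ru uv vu w vw; apply: leq_trans vu _; apply: ru; apply: weq_trans vw.
Qed.

Lemma reduced_factor p u q : reduced (p ++ u ++ q) -> reduced u.
Proof.
move=> h v /(wequiv_cat p q)/h.
by rewrite !size_cat leq_add2l leq_add2r.
Qed.

Lemma reduced_behead s u : reduced (s :: u) -> reduced u.
Proof. by move=> h; apply: (@reduced_factor [:: s] u [::]); rewrite cats0. Qed.

(** Take [v] reduced with [v = sw] in the group; it is no longer than [w]. The word [sv] represents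
    [w] and crosses the wall of [s] at its first letter. It crosses it evenly often afterwards,
    since otherwise deleting a letter of [v] would represent [w] by too short a word. By invariance
    [w] crosses this wall an odd number of times, and deletion applies. *)
Lemma exchange s w : reduced w -> ~ reduced (s :: w) ->
  exists p a q, w = p ++ a :: q /\ s :: w ~ p ++ q.
Proof.
move=> rw nrsw; have [v swv rv] := reduced_exists (s :: w).
have vw : size v <= size w.
  rewrite leqNgt; apply/negP => wv; apply: nrsw.
  exact: reduced_wequiv rv (weq_sym swv) wv.
have wsv : w ~ s :: v by apply/wequiv_move.
apply: (@refl_odd_delete w [:: s]).
rewrite (refl_odd_wequiv [:: s] wsv) /=.
case: pboolP => [_|]; last by case; apply: weq_refl.
apply/negP; rewrite (@refl_odd_wequivr v _ [:: s]); last exact: wequiv_ss.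
move=> /refl_odd_delete[p [a [q [vE svpq]]]].
have := rw _ (weq_trans wsv svpq); move: vw; rewrite vE !size_cat /= addnS.
by move=> h1 /(leq_trans h1); rewrite ltnn.
Qed.

(** Deleting any letter but the last brings two equal letters together, and they cancel; for the
    first letter, the partner is the prepended [t]. *)
Lemma braid_delete s t k p a q : braid s t k = p ++ a :: q ->
  braid s t k.-1 = p ++ q \/ exists2 z, size z < k & t :: p ++ q ~ z.
Proof.
elim: p s t k => [|c p IH] s t [|k] //= [].
  move=> _ E.
  case: k E => [|k] /= E; first by left.
  right; exists (braid s t k); first by rewrite size_braid ltnW.
  by rewrite -E; apply: wequiv_ss.
move=> <- E; case: (IH _ _ _ E) => [pq|[z zk h]]; last first.
  by right; exists (t :: z); [|apply: wequiv_cons].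
by left; rewrite -pq; case: k E pq => [|k _ _] //; case: p {IH}.
Qed.

(** Exchange puts [t] in front of [braid s t k ++ x] and deletes one letter. If it lies in [x], the
    alternating prefix has grown. If it is the last letter of the braid, the two braids agree in the
    group. Any other letter would leave a word that is too short. *)
Lemma dihedral_step s t k w x : reduced w -> ~ reduced (t :: w) ->
    ~ braid s t k ~ braid t s k ->
    w ~ braid s t k ++ x -> size w = k + size x ->
  exists2 x', w ~ braid t s k.+1 ++ x' & size w = k.+1 + size x'.
Proof.
move=> rw nrtw nbr wu sw; set u := _ ++ x in wu.
have su : size u = size w by rewrite size_cat size_braid.
have ru : reduced u by apply: reduced_wequiv rw wu _; rewrite su.
have nrtu : ~ reduced (t :: u).
  move=> h; apply: nrtw; apply: reduced_wequiv h _ _; last by rewrite /= su.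
  by apply: wequiv_cons; apply: weq_sym.
have [p [a [q [uE tupq]]]] := exchange ru nrtu.
have wE : w ~ t :: p ++ q by apply: weq_trans wu _; apply/wequiv_move.
case: (leqP k (size p)) => [kp|pk].
  have pE : p = braid s t k ++ drop k p.
    rewrite -{1}(cat_take_drop k p); congr (_ ++ _).
    have := congr1 (take k) uE.
    by rewrite /u take_size_cat ?size_braid // takel_cat.
  exists (drop k p ++ q); first by rewrite /= catA -pE.
  by rewrite -su uE !size_cat size_drop /= addnA addSn subnKC // addnS.
have [q0 brE qE] : exists2 q0, braid s t k = p ++ a :: q0 & q = q0 ++ x.
  have := congr1 (drop (size p)) uE; have := congr1 (take (size p)) uE.
  rewrite /u takel_cat ?size_braid ?(ltnW pk) // take_size_cat // => tE.
  rewrite drop_cat size_braid pk drop_size_cat //.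
  case D: (drop (size p) (braid s t k)) => [|b d] /=.
    by move: pk; rewrite -subn_gt0 -[k](size_braid s t) -size_drop D.
  case=> ba <-; exists d => //.
  by rewrite -ba -D -[p in p ++ _]tE cat_take_drop.
have uE' : u ~ (t :: p ++ q0) ++ x.
  by apply: weq_trans (weq_sym wu) _; rewrite /= -catA -qE.
case: (braid_delete brE) => [pq|[z zk pqz]].
  case: nbr; have k0 : 0 < k by apply: leq_trans pk.
  have -> : braid t s k = t :: p ++ q0 by rewrite -pq -[in LHS](prednK k0).
  exact: wequiv_cancelr uE'.
have := ru _ (weq_trans uE' (wequiv_catr x pqz)).
by rewrite !size_cat size_braid leq_add2r leqNgt zk.
Qed.

Lemma left_descent_nonreduced s w x : w ~ s :: x -> size w = (size x).+1 ->
  ~ reduced (s :: w).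
Proof.
move=> wsx sw red_sw; have swx : s :: w ~ x by apply/wequiv_move.
by have := red_sw _ swx; rewrite /= sw ltnNge leqnSn.
Qed.

(** The two prefixes must grow together, since [dihedral_step] turns one starting with [s] into a
    longer one starting with [t], and conversely. *)
Lemma dihedral_prefix s t w x y k : reduced w ->
    w ~ s :: x -> size w = (size x).+1 -> w ~ t :: y -> size w = (size y).+1 ->
    (forall j, 0 < j <= k -> ~ braid s t j ~ braid t s j) ->
  (exists2 z, w ~ braid s t k.+1 ++ z & size w = k.+1 + size z) /\
  (exists2 z, w ~ braid t s k.+1 ++ z & size w = k.+1 + size z).
Proof.
move=> rw wx sx wy sy; elim: k => [|k IH] nbr.
  by split; [exists x | exists y]; rewrite ?add1n.
have [|[z1 wz1 sz1] [z2 wz2 sz2]] := IH.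
  by move=> j /andP[j0 jk]; apply: nbr; rewrite j0 ltnW.
have nb := nbr k.+1 (leqnn _); split.
  apply: dihedral_step wz2 sz2 => //; first exact: left_descent_nonreduced wx sx.
  by move=> /weq_sym.
by apply: dihedral_step wz1 sz1 => //; apply: left_descent_nonreduced wy sy.
Qed.

(* Taking the least [k] for which the two braids agree in the group, instead of [m s t],
   dispenses with the theorem that [st] has order exactly [m s t]. It is [0] if there is none. *)
Definition braid_len s t : nat :=
  match excluded_middle_informative
          (exists k, (0 < k) && pbool (braid s t k ~ braid t s k)) with
  | left h => ex_minn h
  | right _ => 0
  end.

Lemma braid_lenP s t : 0 < braid_len s t ->
  braid s t (braid_len s t) ~ braid t s (braid_len s t).
Proof.
rewrite /braid_len; case: excluded_middle_informative => // h _.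
by case: ex_minnP => k /andP[_ /pboolP].
Qed.

Lemma braid_len_min s t k : 0 < k -> braid s t k ~ braid t s k ->
  0 < braid_len s t <= k.
Proof.
move=> k0 /pboolP kb; rewrite /braid_len; case: excluded_middle_informative => [h|[]].
  by case: ex_minnP => j /andP[-> _] /(_ k); rewrite k0 kb => ->.
by exists k; rewrite k0 kb.
Qed.

(** Nothing stops the growth of the prefixes before length [braid_len s t]. If this were [0], they
    would become longer than [w]. *)
Lemma dihedral s t w x y : reduced w ->
    w ~ s :: x -> size w = (size x).+1 -> w ~ t :: y -> size w = (size y).+1 ->
  0 < braid_len s t /\
  exists2 z, w ~ braid s t (braid_len s t) ++ z & size w = braid_len s t + size z.
Proof.
move=> rw wx sx wy sy.
have pre k : (forall j, 0 < j <= k -> ~ braid s t j ~ braid t s j) ->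
    exists2 z, w ~ braid s t k.+1 ++ z & size w = k.+1 + size z.
  by move=> h; case: (dihedral_prefix rw wx sx wy sy h).
case: (posnP (braid_len s t)) => [l0|l0].
  have [|z _] := pre (size w).
    by move=> j /andP[j0 _] /(braid_len_min j0); rewrite l0.
  by move=> sw; have := leq_addr (size z) (size w).+1; rewrite -sw ltnn.
split=> //; rewrite -(prednK l0); apply: pre => j /andP[j0 jl] /(braid_len_min j0).
by rewrite l0 /= leqNgt -(prednK l0) ltnS jl.
Qed.

(* The second list omits exactly the braids [st] of commuting generators. *)
Definition forbidden : seq (seq S) :=
  [seq [:: s; s] | s <- enum S] ++
  [seq braid e.1 e.2 (braid_len e.1 e.2) | e <- enum {: S * S} &
     [&& e.1 != e.2, 0 < braid_len e.1 e.2
       & ~~ (comm m e.1 e.2 && (braid_len e.1 e.2 == 2))]].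

Lemma forbidden_square s : [:: s; s] \in forbidden.
Proof. by rewrite mem_cat map_f // mem_enum. Qed.

Lemma forbidden_braid s t : s != t -> 0 < braid_len s t ->
  ~~ (comm m s t && (braid_len s t == 2)) -> braid s t (braid_len s t) \in forbidden.
Proof.
move=> st l0 nst; rewrite mem_cat orbC; apply/orP; left; apply/mapP; exists (s, t) => //.
by rewrite mem_filter mem_enum /= st l0 nst.
Qed.

(** * Full commutativity as avoidance of the forbidden factors *)

Local Notation avoiding := (avoids m forbidden).

Lemma avoids_cequiv F u v : u =c v -> avoids m F u -> avoids m F v.
Proof. by move=> uv av p f q fF vE; apply: (av p f q fF); apply: ceq_trans vE. Qed.

Lemma avoids_behead F s u : avoids m F (s :: u) -> avoids m F u.
Proof.
by move=> av p f q fF /(cequiv_cons s) uE; apply: (av (s :: p) f q fF).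
Qed.

(** Induction on the length, in the manner of Matsumoto's theorem: two reduced words of one element
    with different first letters are compared through a word starting with a braid, and avoidance
    only lets commutations happen. *)
Lemma avoiding_reduced w : avoiding w ->
  reduced w /\ forall v, w ~ v -> reduced v -> w =c v.
Proof.
have [n] := ubnP (size w); elim: n w => // n IH [|s w] wn av.
  split=> // v wv rv; have := rv _ (weq_sym wv).
  by case: v {wv rv} => // _; apply: ceq_refl.
have [//|rw ceq] := IH w _ (avoids_behead av).
have rsw : reduced (s :: w).
  (* Otherwise exchange and induction bring a second [s] to the front of [w], and the square [ss]
     appears. *)
  apply: NNPP => /(exchange rw)[p [a [q [wE swpq]]]].
  have w_spq : w ~ s :: p ++ q by apply/wequiv_move.
  have : reduced (s :: p ++ q).
    by apply: reduced_wequiv rw w_spq _; rewrite wE /= !size_cat /= addnS.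
  move=> /(ceq _ w_spq)/(cequiv_cons s).
  exact: (av [::] [:: s; s] (p ++ q) (forbidden_square s)).
split=> // -[|t v] wv rv; first by have := reduced_size_eq rsw rv wv.
have [sv] := reduced_size_eq rsw rv wv.
have rv' := reduced_behead rv.
case: (eqVneq s t) => [st|st].
  rewrite -st in wv *; apply: cequiv_cons; apply: ceq => //.
  exact: wequiv_cancel wv.
have [//||l0 [z wz sz]] := dihedral rsw (weq_refl m (s :: w)) _ wv _.
  by rewrite /= sv.
have brE : braid s t (braid_len s t) = s :: braid t s (braid_len s t).-1.
  by case: (braid_len s t) l0.
(* Cancelling [s] makes the induction hypothesis for [w] applicable, so the braid appears within the
   commutation class. *)
have wE : s :: w =c braid s t (braid_len s t) ++ z.
  rewrite brE; apply: cequiv_cons; rewrite brE in wz.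
  have wz' : w ~ braid t s (braid_len s t).-1 ++ z by apply: wequiv_cancel wz.
  apply: ceq => //; apply: reduced_wequiv rw wz' _.
  by rewrite size_cat size_braid -ltnS -[(size w).+1]/(size (s :: w)) sz -addSn prednK.
case: (boolP (comm m s t && (braid_len s t == 2))) => [/andP[/eqP cst /eqP l2]|]; last first.
  by move=> /(forbidden_braid st l0)/av => /(_ [::] z) [].
(* Only a commuting pair is left: [t] moves to the front, where it cancels against the first letter
   of [t :: v]. *)
rewrite l2 /= in wE.
have wE' : s :: w =c [:: t, s & z].
  by apply: ceq_trans wE _; apply: (ceq_rel [::] z cst).
have avsz := avoids_behead (avoids_cequiv wE' av).
have [|_ ceq'] := IH (s :: z) _ avsz.
  by have := cequiv_size wE'; rewrite /= => -[<-].
apply: (ceq_trans wE'); apply: cequiv_cons; apply: ceq' => //.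
apply: (@wequiv_cancel t); apply: weq_trans wv.
by apply: weq_sym; apply: cequiv_wequiv.
Qed.

(** This trace invariant tells the two sides of a braid relation between noncommuting letters
    apart. *)
Lemma cequiv_filter2 s t u v : ~~ comm m s t -> u =c v ->
  [seq c <- u | pred2 s t c] = [seq c <- v | pred2 s t c].
Proof.
move=> nst; elim=> {u v} [//|u v _ -> //|u v w _ -> _ -> //|a b u v ab].
rewrite !filter_cat; congr (_ ++ (_ ++ _)) => /=.
case Ea: ((a == s) || (a == t)); case Eb: ((b == s) || (b == t)) => //=.
move: ab nst; case/orP: Ea => /eqP->; case/orP: Eb => /eqP-> //.
  by rewrite /comm => ->.
by rewrite comm_sym // /comm => ->.
Qed.

Lemma braid_filter2 s t k : [seq c <- braid s t k | pred2 s t c] = braid s t k.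
Proof.
apply/all_filterP; elim: k s t => //= k IH s t; rewrite eqxx /=.
by apply: sub_all (IH t s) => c; rewrite orbC.
Qed.

(** A square could be deleted. Exchanging the sides of a forbidden braid would give a reduced word
    of the same element outside the commutation class. *)
Lemma fully_commutative_avoiding w :
  reduced w -> fully_commutative m w -> avoiding w.
Proof.
move=> rw fc p f q; rewrite mem_cat => /orP[/mapP[s _ ->]|/mapP[[s t]]].
  move=> wE; have wpq : w ~ p ++ q.
    apply: weq_trans (cequiv_wequiv wE) _.
    by apply: wequiv_catl; apply: wequiv_ss.
  by have := rw _ wpq; rewrite (cequiv_size wE) !size_cat leq_add2l ltnNge leqnSn.
rewrite mem_filter /= => /andP[/and3P[st l0 nst] _] -> wE.
have ww1 := cequiv_wequiv wE.
have ww2 := weq_trans ww1 (wequiv_cat p q (braid_lenP l0)).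
have sw := cequiv_size wE.
have r1 : reduced (p ++ braid s t (braid_len s t) ++ q).
  by apply: reduced_wequiv rw ww1 _; rewrite sw.
have r2 : reduced (p ++ braid t s (braid_len s t) ++ q).
  by apply: reduced_wequiv rw ww2 _; rewrite sw !size_cat !size_braid.
have := fc _ _ ww1 ww2 r1 r2.
case: (boolP (comm m s t)) nst => [cst|ncst _].
  move: cst; rewrite /= => /eqP cst l2.
  have : braid_len s t <= 2.
    have /(@braid_len_min s t 2 isT)/andP[//] : braid s t 2 ~ braid t s 2.
    exact: (cequiv_wequiv (ceq_rel [::] [::] cst)).
  (* Only length [1] remains, where [s] and [t] agree in the group; but commutations preserve the
     multiset of letters. *)
  case: (braid_len s t) l0 l2 => [|[|[|]]] // _ _ _ /cequiv_perm.
  rewrite perm_cat2l perm_cat2r => /perm_mem/(_ s).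
  by rewrite !inE eqxx (negbTE st).
move=> /(cequiv_filter2 ncst); rewrite !filter_cat braid_filter2.
have -> : [seq c <- braid t s (braid_len s t) | pred2 s t c] = braid t s (braid_len s t).
  by rewrite -[RHS]braid_filter2; apply: eq_filter => c /=; rewrite orbC.
(* The projections of [p] cancel, and comparing the first letters of the two braids forces
   [s = t]. *)
move/eqP; rewrite eqseq_cat // eqxx /=.
case: (braid_len s t) l0 => //= k _ /eqP[e].
by rewrite e eqxx in st.
Qed.

End CoxeterGroups.

(** * From elements to normal forms *)

Section Counting.
Set Implicit Arguments. Unset Strict Implicit. Unset Printing Implicit Defensive.
Local Open Scope nat_scope.

(** Stated for a relation because representatives of two kinds will be matched by equality in the
    group, with no explicit map between them. *)
Lemma leq_card_rel (T : finType) (A B : {set T}) (R : T -> T -> Prop) :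
    (forall a, a \in A -> exists2 b, b \in B & R a b) ->
    (forall a a' b, a \in A -> a' \in A -> R a b -> R a' b -> a = a') ->
  #|A| <= #|B|.
Proof.
move=> ex uniq; pose f a := odflt a [pick b | (b \in B) && pbool (R a b)].
have fP a : a \in A -> f a \in B /\ R a (f a).
  move=> /ex[b bB Rab]; rewrite /f; case: pickP => [c /andP[? /pboolP]//|/(_ b)].
  by rewrite bB (introT (pboolP _) Rab).
have f_inj : {in A &, injective f}.
  move=> a a' aA a'A ff; apply: (uniq a a' (f a)) => //; first exact: (fP a aA).2.
  by rewrite ff; apply: (fP a' a'A).2.
rewrite -(card_in_imset f_inj); apply: subset_leq_card.
by apply/subsetP => _ /imsetP[a aA ->]; apply: (fP a aA).1.
Qed.

(** Both sets contain one word per fully commutative element: its least reduced word in the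
    enumeration of tuples, or the normal form of its commutation class. Each inequality passes from
    one representative to the other. *)
Lemma card_FC_nf (S : finType) (m : S -> S -> option nat) l : coxeter_matrix m ->
  card_FC m l =
  #|[set w : l.-tuple S | nf m set0 w && pbool (avoids m (forbidden m) w)]|.
Proof.
move=> m_cox; apply/eqP; rewrite eqn_leq; apply/andP; split.
  apply: (leq_card_rel (R := fun u v : l.-tuple S => wequiv m u v)) => [u|u u' v].
    rewrite inE => /pboolP[ru fcu _].
    have [|v nfv uv] := @nf_exists _ _ m_cox set0 u; first by move=> b _; rewrite inE.
    have sv : size v == l by rewrite -(cequiv_size uv) size_tuple.
    exists (Tuple sv); last exact: cequiv_wequiv uv.
    rewrite inE nfv /=; apply/pboolP; apply: (avoids_cequiv uv).
    exact: fully_commutative_avoiding.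
  rewrite !inE => /pboolP[_ _ umin] /pboolP[_ _ u'min] uv u'v.
  have uu' := weq_trans uv (weq_sym u'v).
  apply/enum_rank_inj/val_inj/eqP; rewrite eqn_leq umin ?u'min //.
  exact: weq_sym.
apply: (leq_card_rel (R := fun u v : l.-tuple S => wequiv m u v)) => [u|u u' v].
  rewrite inE => /andP[_ /pboolP/(avoiding_reduced m_cox)[ru ceq]].
  have uu : pbool (wequiv m u u) by apply/pboolP; apply: weq_refl.
  case: (@arg_minnP _ u (fun v : l.-tuple S => pbool (wequiv m u v))
                    (fun v => enum_rank v) uu) => v /pboolP uv vmin.
  exists v => //; rewrite inE; apply/pboolP; split.
  - by apply: reduced_wequiv ru uv _; rewrite !size_tuple.
  - move=> v1 v2 vv1 vv2 r1 r2.
    apply: ceq_trans (ceq_sym (ceq _ (weq_trans uv vv1) r1)) _.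
    exact: ceq _ (weq_trans uv vv2) r2.
  - move=> w wv; apply: vmin; apply/pboolP.
    exact: weq_trans uv (weq_sym wv).
rewrite !inE => /andP[nfu /pboolP/(avoiding_reduced m_cox)[_ ceq]].
move=> /andP[nfu' /pboolP/(avoiding_reduced m_cox)[ru' _]] uv u'v.
apply/val_inj/(nf_uniq m_cox nfu nfu')/ceq => //.
exact: weq_trans uv (weq_sym u'v).
Qed.

End Counting.

(* W^FC(t) = sum_l |W^FC_l| t^l is rational: Q(t) W^FC(t) = P(t) with Q(0) <> 0. *)
Theorem theorem1p1 (S : finType) (m : S -> S -> option nat) :
  coxeter_matrix m ->
  exists P Q : {poly rat},
    Q`_0 != 0 /\
    forall n : nat,
      \sum_(i < n.+1) Q`_i * ((card_FC m (n - i)%N)%:R : rat) = P`_n.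
Proof.
move=> m_cox.
have [P [Q [Q0 QP]]] := avoiding_nf_rational m_cox (forbidden m).
exists P, Q; split=> // n; rewrite -QP.
by apply: eq_bigr => i _; rewrite card_FC_nf.
Qed.
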